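(* For $i=1,2$, let $\lambda_i,\mu_i,\nu_i$ be positive real numbers. Then the Möb-homogeneous analytic Hilbert modules $\mathcal{A}^{(\lambda_1,\mu_1,\nu_1)}$ and $\mathcal{A}^{(\lambda_2,\mu_2,\nu_2)}$ are unitarily equivalent if and only if $\lambda_1=\lambda_2$, $\mu_1=\mu_2$ and $\nu_1=\nu_2$.
   Context: $\mathbb{D}$ is the open unit disc in $\mathbb{C}$. For $\lambda,\mu,\nu>0$, $\mathcal{A}^{(\lambda,\mu,\nu)}$ is the reproducing kernel Hilbert space of holomorphic functions on $\mathbb{D}^2$ with (non-negative definite) reproducing kernel $$K^{(\lambda,\mu,\nu)}(\boldsymbol z,\boldsymbol w)=\frac{1}{4(1-z_1\bar w_1)^{\mu+\lambda}(1-z_2\bar w_2)^{\nu+\lambda}}\left[\frac{1}{(1-z_1\bar w_1)^{2\lambda}(1-z_2\bar w_2)^{2\lambda}}+\frac{3}{(1-z_1\bar w_2)^{2\lambda}(1-z_2\bar w_1)^{2\lambda}}\right]$$ (principal branches). It is an analytic Hilbert module: polynomials are contained and dense in it, and the operators $M_{z_1},M_{z_2}$ of multiplication by the coordinate functions are bounded. (It is Möb-homogeneous: the Taylor joint spectrum of $(M_{z_1},M_{z_2})$ lies in $\overline{\mathbb{D}}^2$ and $(\varphi(M_{z_1}),\varphi(M_{z_2}))$ is unitarily equivalent to $(M_{z_1},M_{z_2})$ for every biholomorphic automorphism $\varphi$ of $\mathbb{D}$.) Two analytic Hilbert modules $\mathcal{H},\mathcal{H}'$ on $\mathbb{D}^2$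 are unitarily equivalent if there is a unitary $U:\mathcal{H}\to\mathcal{H}'$ with $UM_{z_i}=M_{z_i}U$ for $i=1,2$. *)

(* Defs.v *)
From HB Require Import structures.
From mathcomp Require Import all_boot all_order all_algebra.
From mathcomp Require Import sesquilinear.
From mathcomp Require Import complex.
From mathcomp Require Import all_classical all_reals all_analysis.

Set Implicit Arguments.
Unset Strict Implicit.
Unset Printing Implicit Defensive.

Import Order.TTheory GRing.Theory Num.Theory.
Import numFieldNormedType.Exports.

Local Open Scope ring_scope.
Local Open Scope complex_scope.

Section PrincipalPower.
Variable R : realType.
Implicit Type z : R[i].

Definition modulus z : R := complex.Re `|z|.

(* Principal argument, in ]-pi, pi] for z != 0 *)
Definition principal_arg z : R :=
  let t := acos (complex.Re z / modulus z) in
  if 0 <= complex.Im z then t else - t.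

(* z ^ a = exp (a * Log z) for z != 0, with Log the principal logarithm *)
Definition cpow z (a : R) : R[i] :=
  ((modulus z `^ a)%R)%:C *
  (cos (a * principal_arg z) +i* sin (a * principal_arg z)).

End PrincipalPower.

Section HilbertModules.
Variable R : realType.
Local Notation C := (R[i]).

Definition bidisc : set (C * C) := [set z | `|z.1| < 1 /\ `|z.2| < 1].

Definition holomorphic_on_bidisc (f : C * C -> C) : Prop :=
  forall z, bidisc z ->
    differentiable (f : (C^o * C^o)%type -> C^o) (z : (C^o * C^o)%type).

(* A complex inner product space whose elements are functions on the bidisc:
   a vector is determined by the restriction of [hs_eval f] to the bidisc,
   and the values of [hs_eval f] off the bidisc carry no information. *)
Record functionSpace := FunctionSpace {
  hs_sort :> lmodType C ;
  hs_dot : {dot hs_sort for Num.conj} ;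
  hs_eval : {linear hs_sort -> (C * C -> C)} ;
  hs_eval_inj : forall f g : hs_sort,
    (forall z, bidisc z -> hs_eval f z = hs_eval g z) -> f = g
}.

Definition hnorm (H : functionSpace) (f : H) : R :=
  Num.sqrt (complex.Re (hs_dot H f f)).

Definition complete_space (H : functionSpace) : Prop :=
  forall u : nat -> H,
    (forall e : R, 0 < e -> exists N : nat, forall m n : nat,
       (N <= m)%N -> (N <= n)%N -> hnorm (u m - u n) < e) ->
    exists l : H, forall e : R, 0 < e -> exists N : nat, forall n : nat,
       (N <= n)%N -> hnorm (u n - l) < e.

(* The outer variable of p is the second coordinate. *)
Definition represents_poly (H : functionSpace) (f : H)
    (p : {poly {poly C}}) : Prop :=
  forall z, bidisc z -> hs_eval H f z = p.[z.2%:P].[z.1].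

Record analyticHilbertModule := AnalyticHilbertModule {
  ahm_space :> functionSpace ;
  ahm_complete : complete_space ahm_space ;
  ahm_holomorphic : forall f : ahm_space,
    holomorphic_on_bidisc (hs_eval ahm_space f) ;
  ahm_eval_bounded : forall z, bidisc z ->
    exists c : R, forall f : ahm_space,
      modulus (hs_eval ahm_space f z) <= c * hnorm f ;
  ahm_poly : forall p : {poly {poly C}},
    exists f : ahm_space, represents_poly f p ;
  ahm_poly_dense : forall (f : ahm_space) (e : R), 0 < e ->
    exists (p : {poly {poly C}}) (g : ahm_space),
      represents_poly g p /\ hnorm (f - g) < e ;
  ahm_mul1 : {linear ahm_space -> ahm_space} ;
  ahm_mul1E : forall (f : ahm_space) z, bidisc z ->
    hs_eval ahm_space (ahm_mul1 f) z = z.1 * hs_eval ahm_space f z ;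
  ahm_mul1_bounded : exists c : R, forall f : ahm_space,
    hnorm (ahm_mul1 f) <= c * hnorm f ;
  ahm_mul2 : {linear ahm_space -> ahm_space} ;
  ahm_mul2E : forall (f : ahm_space) z, bidisc z ->
    hs_eval ahm_space (ahm_mul2 f) z = z.2 * hs_eval ahm_space f z ;
  ahm_mul2_bounded : exists c : R, forall f : ahm_space,
    hnorm (ahm_mul2 f) <= c * hnorm f
}.

Definition reproducing_kernel (H : functionSpace)
    (K : C * C -> C * C -> C) : Prop :=
  forall w, bidisc w ->
    exists k : H, (forall z, bidisc z -> hs_eval H k z = K z w) /\
      forall f : H, hs_eval H f w = hs_dot H f k.

Definition unitarily_equivalent (H H' : analyticHilbertModule) : Prop :=
  exists U : {linear H -> H'},
    [/\ bijective U,
        forall f g : H, hs_dot H' (U f) (U g) = hs_dot H f g,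
        forall f : H, U (ahm_mul1 H f) = ahm_mul1 H' (U f) &
        forall f : H, U (ahm_mul2 H f) = ahm_mul2 H' (U f)].

Definition kernelA (lambda mu nu : R) (z w : C * C) : C :=
  1 / (4 * cpow (1 - z.1 * Num.conj w.1) (mu + lambda)
         * cpow (1 - z.2 * Num.conj w.2) (nu + lambda)) *
  (1 / (cpow (1 - z.1 * Num.conj w.1) (2 * lambda)
        * cpow (1 - z.2 * Num.conj w.2) (2 * lambda)) +
   3 / (cpow (1 - z.1 * Num.conj w.2) (2 * lambda)
        * cpow (1 - z.2 * Num.conj w.1) (2 * lambda))).

(* A reproducing kernel determines its Hilbert space of functions (Moore and
   Aronszajn), so this pins down H up to equality of functions on the bidisc. *)
Definition is_moduleA (lambda mu nu : R) (H : analyticHilbertModule) : Prop :=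
  reproducing_kernel H (kernelA lambda mu nu).

End HilbertModules.

(* Main.v *)
(* If U is a unitary intertwiner and g = U 1, then U f = f g for polynomials f,
   hence for all f by density, and comparing the two evaluations at w gives
   K'(z, w) = g(z) conj(g(w)) K(z, w). Both kernels equal 1 when one argument
   is 0, so |g| = 1 with g constant and K = K'. On the diagonal slice
   z = (x, 0), w = (-x, 0), with s = 1 + x^2, the kernel is
   (s^-(mu + 3 lambda) + 3 s^-(mu + lambda)) / 4. Its values at s and s^2 give
   A + 3B and A^2 + 3B^2 for A = s^-(mu + 3 lambda) < B = s^-(mu + lambda),
   which determine A and B, hence lambda and mu; the other coordinate gives nu.
   Conversely, spaces with the same kernel have the same functions and the same
   inner product. *)
Require Import Defs.
From HB Require Import structures.
From mathcomp Require Import all_boot all_order all_algebra.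
From mathcomp Require Import sesquilinear complex.
From mathcomp Require Import all_classical all_reals all_analysis.
From mathcomp Require Import ring lra.

Set Implicit Arguments.
Unset Strict Implicit.
Unset Printing Implicit Defensive.

Import Order.TTheory GRing.Theory Num.Theory.

Local Open Scope ring_scope.
Local Open Scope complex_scope.

(** * Two real inequalities for limit arguments *)

Section RealInequalities.
Variable R : realType.

(** Turns an estimate with arbitrary error [e] into a vanishing result. No sign of [c] is assumed: a
    positive [x] forces [0 < c] at [e = 1], and then [e = x / (2 * c)] gives a contradiction. *)
Lemma le0_of_le_mul (x c : R) : (forall e : R, 0 < e -> x <= c * e) -> x <= 0.
Proof.
move=> H; rewrite leNgt; apply/negP => x0.
have c0 : 0 < c by have := H 1 ltr01; rewrite mulr1; exact: lt_le_trans.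
have := H (x / (2 * c)) _; rewrite divr_gt0 ?mulr_gt0// => /(_ isT).
rewrite (_ : c * (x / (2 * c)) = x / 2); last by field; rewrite gt_eqF.
lra.
Qed.

Lemma discriminant_le (a y e : R) : 0 <= a ->
  (forall x : R, 0 <= a * x ^+ 2 - 2 * x * y + e) -> y ^+ 2 <= a * e.
Proof.
rewrite le_eqVlt => /orP[/eqP <-|a0] H.
  rewrite mul0r; have [->|y0] := eqVneq y 0; first by rewrite expr0n.
  (* For [a = 0] the expression is affine in [x]; this point gives it the value -1. *)
  have := H ((e + 1) / (2 * y)); rewrite mul0r sub0r.
  rewrite (_ : 2 * _ * y = e + 1); last by field.
  lra.
(* The minimum of the quadratic. *)
have := H (y / a).
rewrite (_ : _ + e = (a * e - y ^+ 2) / a); last by field; rewrite gt_eqF.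
by rewrite pmulr_lge0 ?invr_gt0// subr_ge0.
Qed.

End RealInequalities.

(** * Orthogonal projection for a real semi-inner product *)

Section Projection.
Variables (R : realType) (V : lmodType R[i]) (q : V -> V -> R).
Hypothesis qD : forall u v w, q (u + v) w = q u w + q v w.
Hypothesis qZ : forall (a : R) u v, q (a%:C *: u) v = a * q u v.
Hypothesis qC : forall u v, q u v = q v u.
Hypothesis q_ge0 : forall u, 0 <= q u u.

Let qDr u v w : q w (u + v) = q w u + q w v.
Proof. by rewrite !(qC w) qD. Qed.

Let qZr (a : R) u v : q v (a%:C *: u) = a * q v u.
Proof. by rewrite !(qC v) qZ. Qed.

Let qN u v : q (- u) v = - q u v.
Proof.
by rewrite -scaleN1r -(mulN1r (q u v)) -qZ rmorphN rmorph1.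
Qed.

Let qNr u v : q v (- u) = - q v u.
Proof. by rewrite !(qC v) qN. Qed.

Lemma cauchy_schwarz_form u v : q u v ^+ 2 <= q v v * q u u.
Proof.
apply: discriminant_le => // x.
suff -> : q v v * x ^+ 2 - 2 * x * q u v + q u u
        = q (u - x%:C *: v) (u - x%:C *: v) by [].
rewrite !(qD, qDr, qN, qNr, qZ, qZr) (qC v u); ring.
Qed.

Variable S : V -> Prop.
Hypothesis S0 : S 0.
Hypothesis SD : forall u v, S u -> S v -> S (u + v).
Hypothesis SZ : forall (a : R) u, S u -> S (a%:C *: u).
Hypothesis S_complete : forall u : nat -> V, (forall n, S (u n)) ->
  (forall e : R, 0 < e -> exists N : nat, forall m n : nat,
     (N <= m)%N -> (N <= n)%N -> q (u m - u n) (u m - u n) < e) ->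
  exists2 l, S l & forall e : R, 0 < e -> exists N : nat, forall n : nat,
     (N <= n)%N -> q (u n - l) (u n - l) < e.

(** A minimizing sequence for the distance from [v] to [S] is Cauchy by the parallelogram law. Its
    terms are nearly orthogonal residuals, and orthogonality passes to the limit by
    Cauchy-Schwarz. *)
Lemma orthogonal_projection v :
  exists2 s, S s & forall t, S t -> q (v - s) t = 0.
Proof.
pose E : set R := [set x | exists2 s, S s & x = q (v - s) (v - s)]%classic.
have E0 : (E !=set0)%classic by exists (q (v - 0) (v - 0)), 0.
have Elb : has_lbound E by exists 0 => x [s _ ->].
have Einf : has_inf E by [].
have d_le s : S s -> inf E <= q (v - s) (v - s).
  by move=> Ss; apply: ge_inf => //; exists s.
have /choice[s sP] : forall n : nat, exists s,
    S s /\ q (v - s) (v - s) < inf E + n.+1%:R^-1.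
  move=> n; have n0 : 0 < n.+1%:R^-1 :> R by rewrite invr_gt0 ltr0n.
  have [x [s Ss ->] lt_s] := inf_adherent n0 Einf.
  by exists s.
have S_s n : S (s n) by case: (sP n).
have inv_small (e : R) : 0 < e ->
    exists N : nat, forall n : nat, (N <= n)%N -> n.+1%:R^-1 < e.
  move=> e0; exists (Num.truncn e^-1) => n Nn.
  rewrite -[e]invrK ltf_pV2 ?posrE ?invr_gt0 ?ltr0n//.
  by rewrite (lt_le_trans (truncnS_gt _))// ler_nat.
have s_dist m n : q (s m - s n) (s m - s n) <= 2 * (m.+1%:R^-1 + n.+1%:R^-1).
  have [_ Hm] := sP m; have [_ Hn] := sP n.
  (* The midpoint lies in [S], so its distance to [v] is bounded below by the infimum in the
     parallelogram law. *)
  have := d_le (2^-1%:C *: (s m + s n)) (SZ _ (SD (S_s m) (S_s n))).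
  move: Hm Hn; rewrite !(qD, qDr, qN, qNr, qZ, qZr).
  rewrite !(qC (s _) v) (qC (s n) (s m)).
  by move: n.+1%:R^-1 m.+1%:R^-1 => a b; lra.
have [|l Sl lP] := S_complete S_s.
  move=> e e0; have [|N NP] := inv_small (e / 4); first by rewrite divr_gt0.
  exists N => m n /NP + /NP; have := s_dist m n.
  by move: n.+1%:R^-1 m.+1%:R^-1 => a b; lra.
exists l => // t St; apply/eqP; rewrite -sqrf_eq0; apply/eqP/le_anti.
(* The 4 comes from (a + b)^2 <= 2 a^2 + 2 b^2, with both squares at most [q t t * e]. *)
rewrite sqr_ge0 andbT; apply: (@le0_of_le_mul _ _ (4 * q t t)) => e e0.
have [N1 H1] := lP _ e0; have [N2 H2] := inv_small _ e0.
pose n := maxn N1 N2.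
have {}H1 := H1 n (leq_maxl _ _); have {}H2 := H2 n (leq_maxr _ _).
have C1 := cauchy_schwarz_form (s n - l) t.
(* Moving from [s n] along [t] lowers the squared distance by at most 1/(n+1), which makes a
   quadratic in [x] nonnegative. *)
have C2 : q (v - s n) t ^+ 2 <= q t t * n.+1%:R^-1.
  apply: discriminant_le => // x.
  have [_ Hn] := sP n.
  have := d_le (s n + x%:C *: t) (SD (S_s n) (SZ _ St)).
  move: Hn; rewrite !(qD, qDr, qN, qNr, qZ, qZr).
  rewrite !(qC (s _) v) (qC t v) (qC t (s n)); move: n.+1%:R^-1 => a; lra.
have -> : q (v - l) t = q (v - s n) t + q (s n - l) t.
  by rewrite -qD addrA subrK.
have C1' : q t t * q (s n - l) (s n - l) <= q t t * e.
  by rewrite ler_wpM2l // ltW.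
have C2' : q t t * n.+1%:R^-1 <= q t t * e by rewrite ler_wpM2l // ltW.
have := sqr_ge0 (q (v - s n) t - q (s n - l) t).
have := le_trans C1 C1'; have := le_trans C2 C2'; lra.
Qed.

End Projection.

(** * The kernel on real slices and recovery of its exponents *)

Section Kernel.
Variable R : realType.
Local Notation C := (R[i]).
Implicit Types (s a l m n x : R) (z w : C * C).

Lemma modulusE (z : C) : (modulus z)%:C = `|z|.
Proof. by rewrite /modulus normc_def. Qed.

Lemma modulus_real s : modulus s%:C = `|s|.
Proof. by rewrite /modulus normc_def /= expr0n addr0 sqrtr_sqr. Qed.

Lemma cpow_real s a : 0 < s -> cpow s%:C a = (s `^ a)%:C.
Proof.
move=> s0; rewrite /cpow /principal_arg modulus_real gtr0_norm//= lexx.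
by rewrite divff ?gt_eqF// acos1 mulr0 cos0 sin0 mulr1.
Qed.

Lemma cpow1 a : cpow (1 : C) a = 1.
Proof. by rewrite (_ : 1 = 1%:C) ?cpow_real ?powR1. Qed.

Lemma kernelA_0r l m n z : kernelA l m n z (0, 0) = 1.
Proof.
by rewrite /kernelA /= conjC0 !mulr0 subr0 !cpow1; field.
Qed.

Lemma kernelA_0l l m n w : kernelA l m n (0, 0) w = 1.
Proof.
by rewrite /kernelA /= !mul0r subr0 !cpow1; field.
Qed.

(** Lets the argument on the first coordinate, which yields mu, also yield nu. *)
Lemma kernelA_swap l m n z w :
  kernelA l m n (z.2, z.1) (w.2, w.1) = kernelA l n m z w.
Proof.
by rewrite /kernelA /= [4 * _ * _]mulrAC [cpow _ (2 * l) * _]mulrC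
  [X in 3 / X]mulrC.
Qed.

Lemma kernelA_slice l m n x : kernelA l m n (x%:C, 0) ((- x)%:C, 0) =
  (((1 + x ^+ 2) `^ (m + l))^-1 *
    (((1 + x ^+ 2) `^ (2 * l))^-1 + 3) / 4)%:C.
Proof.
have s0 : 0 < 1 + x ^+ 2 by rewrite ltr_pwDl ?sqr_ge0.
rewrite /kernelA /= conjC0 !mulr0 !mul0r subr0 !cpow1.
rewrite conj_Creal; last by apply/complex_realP; exists (- x).
rewrite (_ : 1 - _ = (1 + x ^+ 2)%:C); last first.
  by rewrite rmorphN mulrN opprK -rmorphM rmorphD rmorph1 expr2.
rewrite !cpow_real// !mulr1 divr1 !mul1r.
rewrite !rmorphM rmorphD !fmorphV !rmorph_nat invfM; ring.
Qed.

(** With B = P and A = P q, the identity 4 (A^2 + 3 B^2) - (A + 3 B)^2 = 3 (B - A)^2 determines B -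
    A, whose sign is fixed by q < 1. Then A + 3 B = 4 B - (B - A) gives B. *)
Lemma eq_of_weighted_power_sums (P P' : R) (q q' : R) :
  0 < P -> 0 < P' -> q < 1 -> q' < 1 ->
  P * (q + 3) = P' * (q' + 3) ->
  P ^+ 2 * (q ^+ 2 + 3) = P' ^+ 2 * (q' ^+ 2 + 3) -> P = P' /\ q = q'.
Proof.
move=> P0 P'0 q1 q'1 e1 e2.
have D0 : 0 < P * (1 - q) by rewrite mulr_gt0 ?subr_gt0.
have D'0 : 0 < P' * (1 - q') by rewrite mulr_gt0 ?subr_gt0.
have : (P * (1 - q)) ^+ 2 = (P' * (1 - q')) ^+ 2.
  have : (P * (q + 3)) ^+ 2 = (P' * (q' + 3)) ^+ 2 by rewrite e1.
  lra.
move/eqP; rewrite eqrXn2 ?ltW// => /eqP e3.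
have eP : P = P' by lra.
split=> //; move: e1; rewrite eP => /(mulfI (lt0r_neq0 P'0)); lra.
Qed.

Lemma powR_expI s a b : 1 < s -> s `^ a = s `^ b -> a = b.
Proof.
move=> s1 /(congr1 (@ln R)); rewrite !ln_powR => /mulIf; apply.
by rewrite gt_eqF// ln_gt0.
Qed.

Lemma kernelA_exponents l1 m1 n1 l2 m2 n2 : 0 < l1 -> 0 < l2 ->
  (forall x : R, `|x| < 1 ->
    kernelA l1 m1 n1 (x%:C, 0) ((- x)%:C, 0) =
    kernelA l2 m2 n2 (x%:C, 0) ((- x)%:C, 0)) ->
  l1 = l2 /\ m1 = m2.
Proof.
move=> l10 l20 H.
have slice x : `|x| < 1 ->
    ((1 + x ^+ 2) `^ (m1 + l1))^-1 * (((1 + x ^+ 2) `^ (2 * l1))^-1 + 3) =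
    ((1 + x ^+ 2) `^ (m2 + l2))^-1 * (((1 + x ^+ 2) `^ (2 * l2))^-1 + 3).
  move=> /H; rewrite !kernelA_slice => /complexI/mulIf; apply.
  by rewrite invr_eq0.
(* Both [s] and [s * s] = 25/16 have the form 1 + x^2 with x rational in the unit disc: x = 1/2 and
   x = 3/4. *)
pose s : R := 5 / 4.
have s0 : 0 <= s by rewrite /s; lra.
have s1 : 1 < s by rewrite /s; lra.
have e1 : 1 + 2^-1 ^+ 2 = s by rewrite /s; field.
have e2 : 1 + (3 / 4) ^+ 2 = s * s by rewrite /s; field.
have := slice 2^-1; rewrite e1 => /(_ _)/wrap[].
  by rewrite ger0_norm; lra.
have := slice (3 / 4); rewrite e2 => /(_ _)/wrap[].
  by rewrite ger0_norm; lra.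
rewrite !(powRM _ s0 s0) -!expr2 -!exprVn => E2 E1.
have q1 l : 0 < l -> (s `^ (2 * l))^-1 < 1.
  move=> l0; have l20' : 0 < 2 * l by rewrite mulr_gt0.
  have := gt0_ltr_powR l20' _ _ s1; rewrite powR1 !nnegrE => /(_ ler01 s0) h.
  by rewrite invf_lt1 ?h// powR_gt0// (lt_trans ltr01).
have [||||/invr_inj eP /invr_inj eq] := eq_of_weighted_power_sums _ _ _ _ E1 E2.
- by rewrite invr_gt0 powR_gt0// (lt_trans ltr01).
- by rewrite invr_gt0 powR_gt0// (lt_trans ltr01).
- exact: q1.
- exact: q1.
have := powR_expI s1 eP; have := powR_expI s1 eq; lra.
Qed.

End Kernel.

(** * Inner product and evaluation in a function space *)

Section FunctionSpaceTheory.
Variables (R : realType) (H : functionSpace R).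
Implicit Types (f g h : H) (a : R[i]) (z : R[i] * R[i]).

(** The real part is a symmetric real bilinear form, as the projection theorem requires, and
    [rdot f f] is the square of [hnorm f]. *)
Definition rdot f g : R := complex.Re (hs_dot H f g).

Lemma hs_dotDl f g h : hs_dot H (f + g) h = hs_dot H f h + hs_dot H g h.
Proof. exact: linearDl. Qed.

Lemma hs_dotZl a f g : hs_dot H (a *: f) g = a * hs_dot H f g.
Proof. exact: linearZl_LR. Qed.

Lemma hs_dotC f g : hs_dot H f g = Num.conj (hs_dot H g f).
Proof. by rewrite hermC expr0 mul1r. Qed.

Lemma hs_dotZr a f g : hs_dot H f (a *: g) = Num.conj a * hs_dot H f g.
Proof. by rewrite hs_dotC hs_dotZl rmorphM [in RHS]hs_dotC. Qed.

Lemma hs_dotBr f g h : hs_dot H f (g - h) = hs_dot H f g - hs_dot H f h.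
Proof. exact: linearBr. Qed.

Lemma hs_dot_ge0 f : 0 <= hs_dot H f f.
Proof. exact: dnorm_ge0. Qed.

Lemma hs_dot_extl g h : (forall f, hs_dot H f g = hs_dot H f h) -> g = h.
Proof.
move=> E; apply/eqP; rewrite -subr_eq0 -(dnorm_eq0 (hs_dot H)); apply/eqP.
by rewrite [LHS](hs_dotBr (g - h)) E subrr.
Qed.

Lemma rdotDl f g h : rdot (f + g) h = rdot f h + rdot g h.
Proof. by rewrite /rdot hs_dotDl raddfD. Qed.

Lemma rdotNl f g : rdot (- f) g = - rdot f g.
Proof. by rewrite /rdot -raddfN; congr complex.Re; exact: linearNl. Qed.

Lemma rdotZl (r : R) f g : rdot (r%:C *: f) g = r * rdot f g.
Proof. by rewrite /rdot hs_dotZl; case: (hs_dot H f g) => x y /=; ring. Qed.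

Lemma rdotC f g : rdot f g = rdot g f.
Proof. by rewrite /rdot hs_dotC; case: (hs_dot H g f). Qed.

Lemma rdot_ge0 f : 0 <= rdot f f.
Proof. by have := hs_dot_ge0 f; rewrite lecE => /andP[]. Qed.

Lemma hnormE f : hnorm f = Num.sqrt (rdot f f).
Proof. by []. Qed.

Lemma hnorm_lt f (e : R) : 0 < e -> (hnorm f < e) = (rdot f f < e ^+ 2).
Proof.
move=> e0; rewrite hnormE -[X in _ < X](ger0_norm (ltW e0)) -sqrtr_sqr.
by rewrite ltr_sqrt ?exprn_gt0.
Qed.

Lemma hs_evalD f g z : hs_eval H (f + g) z = hs_eval H f z + hs_eval H g z.
Proof. by rewrite linearD. Qed.

Lemma hs_evalB f g z : hs_eval H (f - g) z = hs_eval H f z - hs_eval H g z.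
Proof. by rewrite linearB. Qed.

Lemma hs_evalZ a f z : hs_eval H (a *: f) z = a * hs_eval H f z.
Proof. by rewrite linearZ. Qed.

End FunctionSpaceTheory.

(** * The modulus as a real-valued norm *)

Section Modulus.
Variable R : realType.
Implicit Types x y : R[i].

Lemma modulusD x y : modulus (x + y) <= modulus x + modulus y.
Proof. by rewrite -lecR rmorphD /= !modulusE ler_normD. Qed.

Lemma modulusN x : modulus (- x) = modulus x.
Proof. by rewrite /modulus normrN. Qed.

Lemma modulusM x y : modulus (x * y) = modulus x * modulus y.
Proof. by apply: (@complexI R); rewrite rmorphM /= !modulusE normrM. Qed.

Lemma modulus_ge0 x : 0 <= modulus x.
Proof. by rewrite -lecR modulusE rmorph0 normr_ge0. Qed.

Lemma modulus_le0 x : modulus x <= 0 -> x = 0.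
Proof. by rewrite -lecR modulusE rmorph0 normr_le0 => /eqP. Qed.

Lemma bidisc0 : bidisc ((0, 0) : R[i] * R[i]).
Proof. by split; rewrite /= normr0. Qed.

End Modulus.

(** * Bounded evaluation and completeness in a module *)

Section ModuleTheory.
Variables (R : realType) (H : analyticHilbertModule R).
Implicit Types (f g h : H).

Lemma hs_eval_le z : bidisc z -> exists2 c : R, 0 <= c &
  forall (f : H) e, hnorm f < e -> modulus (hs_eval H f z) <= c * e.
Proof.
(* The given bound has no known sign, hence the absolute value. *)
move=> /(@ahm_eval_bounded _ H)[c cP]; exists `|c| => // f e fe.
apply: le_trans (cP f) _; apply: le_trans (ler_norm _) _.
by rewrite normrM ler_wpM2l// ger0_norm ?sqrtr_ge0// ltW.
Qed.

Lemma complete_rdot (u : nat -> H) :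
  (forall e : R, 0 < e -> exists N : nat, forall m n : nat,
     (N <= m)%N -> (N <= n)%N -> rdot (u m - u n) (u m - u n) < e) ->
  exists l, forall e : R, 0 < e -> exists N : nat, forall n : nat,
     (N <= n)%N -> rdot (u n - l) (u n - l) < e.
Proof.
move=> uC; have [|l lP] := ahm_complete (u := u).
  move=> e e0; have [|N NP] := uC (e ^+ 2); first by rewrite exprn_gt0.
  by exists N => m n Nm Nn; rewrite hnorm_lt// NP.
exists l => e e0; have [|N NP] := lP (Num.sqrt e); first by rewrite sqrtr_gt0.
by exists N => n /NP; rewrite hnorm_lt ?sqrtr_gt0// sqr_sqrtr ?ltW.
Qed.

End ModuleTheory.

(** * Modules with the same kernel are equivalent *)

Section SameKernel.
Variables (R : realType) (H H' : analyticHilbertModule R).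
Variable K : R[i] * R[i] -> R[i] * R[i] -> R[i].
Hypotheses (hK : reproducing_kernel H K) (hK' : reproducing_kernel H' K).

Definition same_function (f : H) (g : H') : Prop :=
  forall z, bidisc z -> hs_eval H f z = hs_eval H' g z.

Lemma same_functionD f1 g1 f2 g2 : same_function f1 g1 ->
  same_function f2 g2 -> same_function (f1 + f2) (g1 + g2).
Proof. by move=> E1 E2 z zD; rewrite !hs_evalD E1// E2. Qed.

Lemma same_functionZ a f g : same_function f g ->
  same_function (a *: f) (a *: g).
Proof. by move=> E z zD; rewrite !hs_evalZ E. Qed.

(** Point evaluations are bounded in both spaces, so agreement of values survives norm limits; this
    closes the subspace of pairs of equal functions. *)
Lemma same_function_complete (u : nat -> H) (v : nat -> H') l l' :
  (forall n, same_function (u n) (v n)) ->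
  (forall e : R, 0 < e -> exists N : nat, forall n : nat,
     (N <= n)%N -> rdot (u n - l) (u n - l) < e) ->
  (forall e : R, 0 < e -> exists N : nat, forall n : nat,
     (N <= n)%N -> rdot (v n - l') (v n - l') < e) ->
  same_function l l'.
Proof.
move=> uv ul vl z zD; apply/eqP; rewrite -subr_eq0; apply/eqP/modulus_le0.
have [c c0 cP] := @hs_eval_le _ H _ zD.
have [c' c'0 c'P] := @hs_eval_le _ H' _ zD.
apply: (@le0_of_le_mul _ _ (c + c')) => e e0.
have [|N NP] := ul (e ^+ 2); first by rewrite exprn_gt0.
have [|N' NP'] := vl (e ^+ 2); first by rewrite exprn_gt0.
pose n := maxn N N'.
have := NP n (leq_maxl _ _); have := NP' n (leq_maxr _ _).
rewrite -!hnorm_lt// => /c'P h' /cP h.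
rewrite (_ : hs_eval H l z - _ =
    hs_eval H' (v n - l') z - hs_eval H (u n - l) z); last first.
  by rewrite !hs_evalB uv//; ring.
rewrite mulrDl addrC; apply: le_trans (modulusD _ _) _.
by rewrite modulusN lerD.
Qed.

(* Project (f0, 0) orthogonally onto the closed subspace of H x H' made of the
   pairs of equal functions. Testing the projection (f, g) against the pairs of
   kernel functions gives f0 - f = g = f, so that f0 = 2 f. *)
Lemma same_kernel_transfer (f0 : H) : exists g0 : H', same_function f0 g0 /\
  forall f g, same_function f g -> hs_dot H f0 f = hs_dot H' g0 g.
Proof.
pose V : lmodType R[i] := (H * H')%type.
pose q (p r : V) : R := rdot p.1 r.1 + rdot p.2 r.2.
pose S (p : V) : Prop := same_function p.1 p.2.
have [||||||||[f g] /= Sfg fgP] :=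
  @orthogonal_projection R V q _ _ _ _ S _ _ _ _ (f0, 0).
- by move=> u v w; rewrite /q !rdotDl addrACA.
- by move=> a u v; rewrite /q !rdotZl mulrDr.
- by move=> u v; rewrite /q !(rdotC u.1) !(rdotC u.2).
- by move=> u; rewrite addr_ge0// rdot_ge0.
- by move=> z zD; rewrite !linear0.
- by move=> u v; exact: same_functionD.
- by move=> a u; exact: same_functionZ.
- move=> u uS uC.
  have [e e0|l lP] := complete_rdot (u := fst \o u).
    have [N NP] := uC _ e0; exists N => m n Nm Nn.
    by apply: le_lt_trans (NP _ _ Nm Nn); rewrite lerDl rdot_ge0.
  have [e e0|l' lP'] := complete_rdot (u := snd \o u).
    have [N NP] := uC _ e0; exists N => m n Nm Nn.
    by apply: le_lt_trans (NP _ _ Nm Nn); rewrite lerDr rdot_ge0.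
  exists (l, l'); first exact: same_function_complete lP lP'.
  move=> e e0; have e20 : 0 < e / 2 by rewrite divr_gt0.
  have [N NP] := lP _ e20; have [N' NP'] := lP' _ e20.
  exists (maxn N N') => n; rewrite geq_max => /andP[/NP + /NP'].
  rewrite /q/=; lra.
have dot_eq f1 g1 : same_function f1 g1 ->
    hs_dot H (f0 - f) f1 = hs_dot H' g g1.
  move=> E1.
  have Re_eq f2 g2 : same_function f2 g2 -> rdot (f0 - f) f2 = rdot g g2.
    move=> /(fgP (f2, g2)); rewrite /q /= sub0r rdotNl => /eqP.
    by rewrite subr_eq0 => /eqP.
  (* Orthogonality gives real parts only; testing against ['i] times the pair gives the imaginary
     parts. *)
  have := Re_eq _ _ (same_functionZ 'i%C E1); have := Re_eq _ _ E1.
  rewrite /rdot !hs_dotZr.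
  case: (hs_dot H _ _) => a b; case: (hs_dot H' _ _) => a' b' /= -> h.
  by move: h; rewrite !mul0r !mulN1r !sub0r !opprK => ->.
have f0E : f0 - f = f.
  apply: hs_eval_inj => z zD; have [k [kE kP]] := hK zD.
  have [k' [kE' kP']] := hK' zD.
  rewrite kP (dot_eq _ k') => [|w wD]; last by rewrite kE// kE'.
  by rewrite -kP' Sfg.
have f0f : f0 = 2 *: f by rewrite scaler_nat mulr2n -{1}f0E subrK.
exists (2 *: g); split; first by rewrite f0f; exact: same_functionZ.
by move=> f1 g1 E1; rewrite f0f !hs_dotZl -[in LHS]f0E (dot_eq _ _ E1).
Qed.

End SameKernel.

(** The unitary sends each element to the one with the same values. Choice gives only a bare map;
    linearity, invertibility and intertwining follow because values on the bidisc determine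
    vectors. *)
Lemma same_kernel_equivalent (R : realType) (H H' : analyticHilbertModule R) K :
  reproducing_kernel H K -> reproducing_kernel H' K ->
  unitarily_equivalent H H'.
Proof.
move=> hK hK'.
have /choice[U UP] := same_kernel_transfer hK hK'.
have /choice[U' UP'] := same_kernel_transfer hK' hK.
have UE f z : bidisc z -> hs_eval H' (U f) z = hs_eval H f z.
  by move=> zD; rewrite (UP f).1.
have U'E f z : bidisc z -> hs_eval H (U' f) z = hs_eval H' f z.
  by move=> zD; rewrite (UP' f).1.
have U_linear : linear U.
  move=> a f g; apply: hs_eval_inj => z zD.
  by rewrite !(UE, hs_evalD, hs_evalZ).
pose Ul : {linear H -> H'} :=
  HB.pack U (GRing.isLinear.Build R[i] H H' _ U U_linear).
exists Ul; split.
- exists U' => f; apply: hs_eval_inj => z zD; first by rewrite U'E// UE.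
  by rewrite UE// U'E.
- by move=> f g; rewrite -((UP f).2 _ _ (UP g).1).
- by move=> f; apply: hs_eval_inj => z zD; rewrite UE// !ahm_mul1E// UE.
- by move=> f; apply: hs_eval_inj => z zD; rewrite UE// !ahm_mul2E// UE.
Qed.

(** * An isometric intertwiner is multiplication by the image of 1 *)

Section Intertwiner.
Variables (R : realType) (H H' : analyticHilbertModule R).
Variable U : {linear H -> H'}.
Hypothesis U_dot : forall f g : H, hs_dot H' (U f) (U g) = hs_dot H f g.
Hypothesis U_mul1 : forall f : H, U (ahm_mul1 H f) = ahm_mul1 H' (U f).
Hypothesis U_mul2 : forall f : H, U (ahm_mul2 H f) = ahm_mul2 H' (U f).
Variable one : H.
Hypothesis oneE : forall z, bidisc z -> hs_eval H one z = 1.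

Let mult_by_U1 (f : H) := forall z, bidisc z ->
  hs_eval H' (U f) z = hs_eval H f z * hs_eval H' (U one) z.

(** Horner induction in the first coordinate: each factor [z.1] passes through [U] by [U_mul1]. *)
Lemma intertwiner_poly1 (c : {poly R[i]}) (f : H) :
  represents_poly f c%:P -> mult_by_U1 f.
Proof.
elim/poly_ind: c f => [|c a IH] f fP z zD.
  have -> : f = 0.
    by apply: hs_eval_inj => w wD; rewrite fP// !hornerE linear0.
  by rewrite !linear0 mul0r.
have [g gP] := ahm_poly H c%:P.
have -> : f = ahm_mul1 H g + a *: one.
  apply: hs_eval_inj => w wD; rewrite hs_evalD hs_evalZ ahm_mul1E//.
  by rewrite fP// gP// oneE// !hornerE mulrC.
rewrite linearD linearZ U_mul1 !hs_evalD !hs_evalZ !ahm_mul1E// (IH _ gP)//.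
by rewrite oneE//; ring.
Qed.

(** Horner induction in the second coordinate, whose coefficients are polynomials in the first. *)
Lemma intertwiner_poly (p : {poly {poly R[i]}}) (f : H) :
  represents_poly f p -> mult_by_U1 f.
Proof.
elim/poly_ind: p f => [|p c IH] f fP.
  by apply: (intertwiner_poly1 (c := 0)); rewrite polyC0.
have [g gP] := ahm_poly H p; have [h hP] := ahm_poly H c%:P.
have -> : f = ahm_mul2 H g + h.
  apply: hs_eval_inj => w wD; rewrite hs_evalD ahm_mul2E//.
  by rewrite fP// gP// hP// !hornerE mulrC.
move=> z zD; rewrite linearD U_mul2 !hs_evalD !ahm_mul2E// (IH _ gP)//.
by rewrite (intertwiner_poly1 hP)//; ring.
Qed.

(** At a fixed point both sides are continuous in [f], so the identity extends from the dense
    polynomials. *)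
Lemma intertwiner_mult (f : H) : mult_by_U1 f.
Proof.
move=> z zD; set u := hs_eval H' (U one) z.
have [c c0 cP] := @hs_eval_le _ H _ zD.
have [c' c'0 c'P] := @hs_eval_le _ H' _ zD.
apply/eqP; rewrite -subr_eq0; apply/eqP/modulus_le0.
apply: (@le0_of_le_mul _ _ (c' + c * modulus u)) => e e0.
have [p [g [gP fg]]] := ahm_poly_dense f e0.
have Ufg : hnorm (U (f - g)) < e.
  by rewrite hnormE /rdot U_dot -/(rdot _ _) -hnormE.
rewrite (_ : _ - _ =
    hs_eval H' (U (f - g)) z - hs_eval H (f - g) z * u); last first.
  rewrite linearB !hs_evalB (intertwiner_poly gP)// -/u; ring.
apply: le_trans (modulusD _ _) _; rewrite modulusN modulusM mulrDl lerD//.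
  exact: c'P.
by rewrite mulrAC ler_wpM2r ?modulus_ge0// cP.
Qed.

Hypothesis U_surj : forall f' : H', exists f, U f = f'.

(* Evaluating U f at w both ways shows that U k_w and k'_w are proportional. *)
Lemma intertwiner_kernel K K' :
  reproducing_kernel H K -> reproducing_kernel H' K' ->
  forall z w, bidisc z -> bidisc w ->
  K' z w = hs_eval H' (U one) z * K z w * Num.conj (hs_eval H' (U one) w).
Proof.
move=> hK hK' z w zD wD; set u := hs_eval H' (U one).
have [k [kE kP]] := hK w wD; have [k' [kE' kP']] := hK' w wD.
have -> : K' z w = hs_eval H' (Num.conj (u w) *: U k) z.
  rewrite -kE'//; congr (hs_eval H' _ z).
  apply: hs_dot_extl => f'; have [f <-] := U_surj f'.
  by rewrite -kP' hs_dotZr conjCK U_dot -kP intertwiner_mult// mulrC.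
by rewrite hs_evalZ intertwiner_mult// kE// -/u; ring.
Qed.

End Intertwiner.

(** * From equivalence to equal kernels and equal parameters *)

Lemma equivalent_same_kernel (R : realType) (H H' : analyticHilbertModule R)
    K K' :
  reproducing_kernel H K -> reproducing_kernel H' K' ->
  (forall z, bidisc z -> K z (0, 0) = 1) ->
  (forall z, bidisc z -> K' z (0, 0) = 1) ->
  (forall w, bidisc w -> K (0, 0) w = 1) ->
  (forall w, bidisc w -> K' (0, 0) w = 1) ->
  unitarily_equivalent H H' ->
  forall z w, bidisc z -> bidisc w -> K z w = K' z w.
Proof.
move=> hK hK' K0r K'0r K0l K'0l [U [[U' _ UU'] U_dot U_mul1 U_mul2]] z w zD wD.
(* The constant 1 is the kernel function at the origin. *)
have D0 := bidisc0 R; have [one [oneK _]] := hK _ D0.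
have oneE z' : bidisc z' -> hs_eval H one z' = 1 by move=> ?; rewrite oneK ?K0r.
have U_surj f' : exists f, U f = f' by exists (U' f').
have := intertwiner_kernel U_dot U_mul1 U_mul2 oneE U_surj hK hK'.
set u := hs_eval H' (U one) => KK'.
have Ez := KK' _ _ zD D0; have Ew := KK' _ _ D0 wD; have E0 := KK' _ _ D0 D0.
move: Ez Ew E0; rewrite !K0r// !K'0r// K0l// K'0l// !mulr1 => Ez Ew E0.
rewrite KK'// mulrAC (_ : u z * _ = 1) ?mul1r//.
(* Inserting |u(0, 0)|^2 = 1 lets the product regroup into the two factors that [Ez] and [Ew] show
   to be 1. *)
transitivity (u z * Num.conj (u w) * (u (0, 0) * Num.conj (u (0, 0)))).
  by rewrite -E0 mulr1.
by rewrite mulrACA [Num.conj _ * _]mulrC mulrACA -Ez -Ew mulr1.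
Qed.

Theorem theorem4p2 (R : realType)
    (lambda1 mu1 nu1 lambda2 mu2 nu2 : R)
    (hlambda1 : 0 < lambda1) (hmu1 : 0 < mu1) (hnu1 : 0 < nu1)
    (hlambda2 : 0 < lambda2) (hmu2 : 0 < mu2) (hnu2 : 0 < nu2)
    (A1 A2 : analyticHilbertModule R)
    (hA1 : is_moduleA lambda1 mu1 nu1 A1)
    (hA2 : is_moduleA lambda2 mu2 nu2 A2) :
  unitarily_equivalent A1 A2 <->
  [/\ lambda1 = lambda2, mu1 = mu2 & nu1 = nu2].
Proof.
split=> [equiv|[el em en]]; last first.
  by subst; exact: same_kernel_equivalent hA1 hA2.
have KK' := equivalent_same_kernel hA1 hA2 (fun z _ => kernelA_0r _ _ _ z)
  (fun z _ => kernelA_0r _ _ _ z) (fun w _ => kernelA_0l _ _ _ w)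
  (fun w _ => kernelA_0l _ _ _ w) equiv.
have norm_real (x : R) : `|x| < 1 -> `|x%:C| < 1 :> R[i].
  by rewrite -modulusE modulus_real -ltcR.
have [el em] : lambda1 = lambda2 /\ mu1 = mu2.
  apply: (kernelA_exponents (n1 := nu1) (n2 := nu2)) => // x x1.
  by apply: KK'; split; rewrite /= ?normr0 ?norm_real ?normrN.
have [_ en] : lambda1 = lambda2 /\ nu1 = nu2.
  apply: (kernelA_exponents (n1 := mu1) (n2 := mu2)) => // x x1.
  rewrite -[LHS]kernelA_swap -[RHS]kernelA_swap.
  by apply: KK'; split; rewrite /= ?normr0 ?norm_real ?normrN.
by split.
Qed.
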